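(* Let $K\subset\mathbb{R}^d$ be non-empty and compact, with $\beta=\dim_{\mathrm{L}} K$. Then there exists a weak tangent $F\in\operatorname{Tan}(K)$ such that $\mathcal{P}^\beta_0(F)\leq 257^\beta<\infty$. (In particular $\mathcal{P}^\beta(F)<\infty$.)
   Context: $B(x,r)$ denotes the closed ball; $N_r(F)$ is the minimal number of closed $r$-balls centred in $F$ covering $F$. Lower dimension: $\dim_{\mathrm{L}} K=\sup\{s>0:\exists C>0\ \forall 0<r\leq R<1\ \forall x\in K,\ N_r(B(x,R)\cap K)\geq C(R/r)^s\}$ (with $\sup\varnothing=0$). A weak tangent of $K$ is any limit in the Hausdorff metric of a sequence of non-empty sets $\lambda_n(K-x_n)\cap B(0,1)$ with $x_n\in K$, $\lambda_n\geq1$ and $\lambda_n\to\infty$; $\operatorname{Tan}(K)$ is the set of weak tangents. The $s$-dimensional packing pre-measure of $E\subset\mathbb{R}^d$ is $\mathcal{P}^s_0(E)=\lim_{\delta\to0}\sup\{\sum_i(2r_i)^s:\{B(x_i,r_i)\}_i\text{ pairwise disjoint, }r_i\leq\delta,\ x_i\in E\}$, and the packing measure is $\mathcal{P}^s(E)=\inf\{\sum_i\mathcal{P}^s_0(E_i):E\subset\bigcup_iE_i\}$. *)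

(* Defs.v *)
From HB Require Import structures.
From mathcomp Require Import all_boot all_order all_algebra.
From mathcomp Require Import all_classical all_reals all_analysis.
Set Implicit Arguments. Unset Strict Implicit. Unset Printing Implicit Defensive.
Import Order.TTheory GRing.Theory Num.Theory.
Import numFieldNormedType.Exports.
Local Open Scope classical_set_scope.
Local Open Scope ring_scope.

Section Defs.
Variables (R : realType) (d : nat).
Local Notation pt := 'rV[R]_d.

Definition enorm (x : pt) : R := Num.sqrt (\sum_(i < d) (x ord0 i) ^+ 2).
Definition edist (x y : pt) : R := enorm (x - y).

Definition cball (x : pt) (r : R) : set pt := [set y | edist x y <= r].

Definition has_cover (F : set pt) (r : R) (n : nat) : Prop :=
  exists c : 'I_n -> pt, (forall i, F (c i)) /\
    F `<=` \bigcup_(i in [set: 'I_n]) cball (c i) r.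

(* N_r(F) >= b, where N_r(F) is the minimal size of such a cover
   (this unfolds "min {n | has_cover F r n} >= b"; vacuous if no finite cover) *)
Definition Ncov_ge (F : set pt) (r : R) (b : R) : Prop :=
  forall n, has_cover F r n -> b <= n%:R.

Definition lowdim_set (K : set pt) : set R :=
  [set s | 0 < s /\ exists C : R, 0 < C /\
     forall r Rr : R, 0 < r -> r <= Rr -> Rr < 1 ->
       forall x, K x -> Ncov_ge (cball x Rr `&` K) r (C * powR (Rr / r) s)].

(* lower dimension; [sup set0 = 0] by definition of [sup] in mathcomp *)
Definition dimL (K : set pt) : R := sup (lowdim_set K).

Definition enbhd (A : set pt) (e : R) : set pt :=
  [set y | exists2 a, A a & edist a y <= e].

Definition hdist (A B : set pt) : \bar R :=
  ereal_inf [set (e%:E)%E | e in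
    [set e : R | 0 <= e /\ A `<=` enbhd B e /\ B `<=` enbhd A e]].

Definition weak_tangent (K F : set pt) : Prop :=
  F !=set0 /\ compact F /\
  exists (x : nat -> pt) (lam : R^nat),
    (forall n, K (x n)) /\ (forall n, 1 <= lam n) /\ (lam @ \oo --> +oo) /\
    let A n := [set lam n *: (y - x n) | y in K] `&` cball 0 1 in
    (forall n, A n !=set0) /\
    ((fun n => hdist (A n) F) @ \oo --> 0%E).

(* s-dimensional packing pre-measure: lim_{delta->0} of a quantity that is
   nonincreasing as delta decreases, i.e. its infimum over delta > 0.
   Families of balls are indexed by countable sets I of nat. *)
Definition pack_sum (s : R) (E : set pt) (delta : R) : set (\bar R) :=
  [set v | exists (I : set nat) (x : nat -> pt) (r : nat -> R),
       (forall i, I i -> 0 < r i /\ r i <= delta /\ E (x i)) /\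
       (forall i j, I i -> I j -> i <> j ->
          cball (x i) (r i) `&` cball (x j) (r j) = set0) /\
       v = (\esum_(i in I) ((powR (2 * r i) s)%:E))%E].

Definition packing_pre (s : R) (E : set pt) : \bar R :=
  ereal_inf [set ereal_sup (pack_sum s E delta) | delta in [set delta : R | 0 < delta]].

Definition packing_measure (s : R) (E : set pt) : \bar R :=
  ereal_inf [set (\esum_(i in [set: nat]) packing_pre s (Ei i))%E |
     Ei in [set Ei : nat -> set pt | E `<=` \bigcup_i Ei i]].

End Defs.

(* Main.v *)
(** Fix [s > dim_L K] and [eps > 0].  If every ball [B(x, rho)] centred in [K],
    with [rho] small, contained a disjoint family of balls centred in
    [K `&` B(x, rho)], with radii [r_i] in [eps rho, rho] and
    [\sum (2 r_i)^s >= (4 rho)^s], then applying this to [B(x, rho / 2)], then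
    inside each ball obtained, and stopping when the radius drops below a given
    scale, would yield disjoint families of balls of comparable radii [r] in
    [B(x, rho)] with at least [c (rho / r)^s] members, so that
    [s <= dim_L K].  Hence for [s_n] decreasing to [dim_L K] and [eps_n -> 0]
    there are balls [B(x_n, rho_n)], [rho_n -> 0], all of whose packings with
    relative radii between [eps_n] and [1] have sum at most [(4 rho_n)^s_n].  A finite
    packing of a Hausdorff limit [F] of the rescaled sets can be moved to these
    sets without changing the radii, hence [P_0^beta(F) <= 4^beta].  The limit
    is taken along an ultrafilter. *)
Require Import Defs.
From HB Require Import structures.
From mathcomp Require Import all_boot all_order all_algebra.
From mathcomp Require Import all_classical all_reals all_analysis.
From mathcomp Require Import ring lra zify.
Import Order.TTheory GRing.Theory Num.Theory.
Import numFieldNormedType.Exports.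
(* Again last: MathComp-Analysis has its own [edist]. *)
Import Defs.
Local Open Scope classical_set_scope.
Local Open Scope ring_scope.

Set Implicit Arguments.
Unset Strict Implicit.

(** * Euclidean norm, its comparison with the sup norm, and closed balls *)

Section EuclideanNorm.
Variables (R : realType) (d : nat).
Local Notation pt := 'rV[R]_d.
Implicit Types (x y z : pt) (r : R).

Lemma sum_sqr_ge0 x : 0 <= \sum_(i < d) (x ord0 i) ^+ 2.
Proof. by apply: sumr_ge0 => i _; exact: sqr_ge0. Qed.

Lemma enorm_ge0 x : 0 <= enorm x.
Proof. exact: sqrtr_ge0. Qed.

Lemma sqr_enorm x : enorm x ^+ 2 = \sum_(i < d) (x ord0 i) ^+ 2.
Proof. exact/sqr_sqrtr/sum_sqr_ge0. Qed.

Lemma enorm0 : enorm (0 : pt) = 0.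
Proof.
by rewrite /enorm big1 ?sqrtr0 // => i _; rewrite mxE expr0n.
Qed.

Lemma enormZ a x : enorm (a *: x) = `|a| * enorm x.
Proof.
rewrite /enorm -sqrtr_sqr -sqrtrM ?sqr_ge0 // mulr_sumr; congr (Num.sqrt _).
by apply: eq_bigr => i _; rewrite mxE exprMn.
Qed.

Lemma enormN x : enorm (- x) = enorm x.
Proof. by rewrite -scaleN1r enormZ normrN1 mul1r. Qed.

Lemma coord_le_enorm x i : `|x ord0 i| <= enorm x.
Proof.
rewrite -[leLHS]ger0_norm // -sqrtr_sqr ler_wsqrtr // real_normK ?num_real //.
by rewrite (bigD1 i) //= lerDl sumr_ge0 // => j _; exact: sqr_ge0.
Qed.

Lemma enorm_eq0 x : enorm x = 0 -> x = 0.
Proof.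
move=> x0; apply/rowP => i; rewrite mxE; apply/eqP.
by rewrite -normr_le0 -x0 coord_le_enorm.
Qed.

(** With [a], [b] the two norms, the weighted inequality [(u + v)^2 <= (1 + b/a) u^2 + (1 + a/b)
    v^2] in each coordinate sums to exactly [(a + b)^2], which replaces Cauchy-Schwarz. *)
Lemma enormD x y : enorm (x + y) <= enorm x + enorm y.
Proof.
have [/enorm_eq0 ->|x0] := eqVneq (enorm x) 0; first by rewrite enorm0 !add0r.
have [/enorm_eq0 ->|y0] := eqVneq (enorm y) 0; first by rewrite enorm0 !addr0.
have a0 : 0 < enorm x by rewrite lt_def x0 enorm_ge0.
have b0 : 0 < enorm y by rewrite lt_def y0 enorm_ge0.
set a := enorm x in a0 *; set b := enorm y in b0 *.
rewrite -(ler_pXn2r (n := 2)) ?nnegrE ?enorm_ge0 ?addr_ge0 ?enorm_ge0 //.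
have -> : (a + b) ^+ 2 = (1 + b / a) * a ^+ 2 + (1 + a / b) * b ^+ 2.
  by field; rewrite !gt_eqF.
rewrite (sqr_enorm (x + y)) (sqr_enorm x : a ^+ 2 = _) (sqr_enorm y : b ^+ 2 = _).
rewrite !mulr_sumr -big_split /=.
apply: ler_sum => i _; rewrite mxE -subr_ge0.
set u := x ord0 i; set v := y ord0 i.
have -> : (1 + b / a) * u ^+ 2 + (1 + a / b) * v ^+ 2 - (u + v) ^+ 2 =
  (b * u - a * v) ^+ 2 / (a * b) by field; rewrite !gt_eqF.
by rewrite divr_ge0 ?sqr_ge0 // mulr_ge0 // ltW.
Qed.

Lemma edistC x y : edist x y = edist y x.
Proof. by rewrite /edist -enormN opprB. Qed.

Lemma edistxx x : edist x x = 0.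
Proof. by rewrite /edist subrr enorm0. Qed.

Lemma edist_triangle z x y : edist x y <= edist x z + edist z y.
Proof. by rewrite /edist -[x - y](subrKA z) enormD. Qed.

Lemma enorm_le_coord x r : (forall i, `|x ord0 i| <= r) -> enorm x <= d%:R * r.
Proof.
case: d x => [|n] x xr.
  by rewrite /enorm big_ord0 sqrtr0 mul0r.
have r0 : 0 <= r by apply: le_trans (xr ord0).
have dr0 : 0 <= n.+1%:R * r by rewrite mulr_ge0.
rewrite -[leRHS]ger0_norm // -sqrtr_sqr ler_wsqrtr //.
apply: (@le_trans _ _ (\sum_(i < n.+1) r ^+ 2)).
  apply: ler_sum => i _.
  by rewrite -real_normK ?num_real // ler_pXn2r ?nnegrE.
rewrite sumr_const card_ord -[leLHS]mulr_natl exprMn ler_wpM2r ?sqr_ge0 //.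
by rewrite -natrX ler_nat expnS expn1 leq_pmulr.
Qed.

Lemma coord_le_norm x i : `|x ord0 i| <= `|x|.
Proof.
rewrite [leRHS]/Num.norm /= mx_normrE; apply/bigmax_geP; right => /=.
by exists (ord0, i).
Qed.

Lemma norm_le_enorm x : `|x| <= enorm x.
Proof.
rewrite [leLHS]/Num.norm /= mx_normrE; apply/bigmax_leP; split; first exact: enorm_ge0.
by move=> [i j] _; rewrite (ord1 i) coord_le_enorm.
Qed.

Lemma enorm_le_norm x : enorm x <= d%:R * `|x|.
Proof. exact: enorm_le_coord (coord_le_norm x). Qed.

Lemma cball_nbhs x r : 0 < r -> nbhs x (cball x r).
Proof.
(* The ambient topology is that of the sup norm; [d.+1] instead of [d] keeps the divisor nonzero in
   dimension 0. *)
move=> r0; apply/nbhs_ballP; exists (r / d.+1%:R) => /=; first by rewrite divr_gt0.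
move=> y; rewrite -ball_normE /= => xy; apply: le_trans (enorm_le_norm _) _.
rewrite (le_trans (ler_wpM2l (ler0n _ _) (ltW xy))) //.
rewrite mulrCA ger_pMr // ler_pdivrMr // mul1r ler_nat.
exact: leqnSn.
Qed.

Lemma closure_cball (A : set pt) x r :
  closure A x -> 0 < r -> exists2 y, A y & edist x y <= r.
Proof. by move=> Ax r0; have [y [Ay xy]] := Ax _ (cball_nbhs x r0); exists y. Qed.

Lemma cball_closed x r : closed (cball x r).
Proof.
move=> y yx; rewrite /cball /=; apply/ler_addgt0Pr => e e0.
have [z zx yz] := closure_cball yx e0.
by rewrite (le_trans (edist_triangle z _ _)) // lerD // edistC.
Qed.

Lemma compact_sub_cball (A : set pt) r :
  closed A -> A `<=` cball 0 r -> compact A.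
Proof.
move=> Acl Ar; apply: bounded_closed_compact Acl.
exists r; split; first exact: num_real.
move=> s rs x /Ar; rewrite /cball /= edistC /edist subr0 => xr.
by apply: le_trans (norm_le_enorm x) _; exact: le_trans xr (ltW rs).
Qed.

Lemma compact_cball x r : compact (cball x r).
Proof.
apply: (@compact_sub_cball _ (enorm x + r)); first exact: cball_closed.
move=> y xy; apply: le_trans (edist_triangle x _ _) _.
by rewrite lerD // edistC /edist subr0.
Qed.

(** Otherwise the point dividing the segment from [x] to [y] in the ratio [r : s] lies in both
    balls. The strict inequality is an open condition, which later survives small moves of the
    centres. *)
Lemma cball_disjoint_lt x y r s : 0 < r -> 0 < s ->
  cball x r `&` cball y s = set0 -> r + s < edist x y.
Proof.
move=> r0 s0 xy0; rewrite ltNge; apply/negP => xy.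
have rs0 : 0 < r + s by exact: addr_gt0.
suff : (cball x r `&` cball y s) (x + (r / (r + s)) *: (y - x)) by rewrite xy0.
split; rewrite /cball /=.
  rewrite /edist opprD addNKr enormN enormZ ger0_norm ?divr_ge0 ?(ltW r0) ?(ltW s0)
    ?(ltW rs0) //.
  rewrite -[enorm _]/(edist y x) edistC.
  by rewrite mulrAC ler_pdivrMr // ler_wpM2l // ltW.
rewrite /edist (_ : _ - _ = (s / (r + s)) *: (y - x)); last first.
  apply/rowP => i; rewrite !mxE; field; exact: lt0r_neq0.
rewrite enormZ ger0_norm ?divr_ge0 ?(ltW r0) ?(ltW s0) ?(ltW rs0) //.
rewrite -[enorm _]/(edist y x) edistC.
by rewrite mulrAC ler_pdivrMr // ler_wpM2l // ltW.
Qed.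

End EuclideanNorm.

(** * Covering numbers and finiteness of the lower dimension *)

Section Covers.
Variables (R : realType) (d : nat).
Local Notation pt := 'rV[R]_d.

Lemma truncn_eq_dist (a b : R) :
  0 <= a -> 0 <= b -> Num.truncn a = Num.truncn b -> `|a - b| <= 1.
Proof.
move=> /truncn_itv/andP[a1 a2] /truncn_itv/andP[b1 b2] ab.
move: a1 a2; rewrite ab => a1 a2.
rewrite -natr1 in a2, b2.
by rewrite ler_norml; lra.
Qed.

(** Points in one grid cell of side [1 / L] differ by at most [1 / L] in each coordinate. Centres
    must lie in [E], so each cell that meets [E] contributes one of its points of [E], and the other
    cells contribute [e0]. *)
Lemma grid_cover (x : pt) (E : set pt) (L : nat) : (0 < L)%N ->
  E !=set0 -> E `<=` cball x 1 ->
  has_cover E (d%:R / L%:R) ((2 * L).+1 ^ d).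
Proof.
move=> L0 [e0 Ee0] Ex.
have L0' : 0 < L%:R :> R by rewrite ltr0n.
pose T := {ffun 'I_d -> 'I_(2 * L).+1}.
(* These rescaled coordinates range over the closed interval [[0, 2L]], whence [2L + 1] integer
   parts per axis. *)
pose v (y : pt) i : R := (y ord0 i - x ord0 i + 1) * L%:R.
have vP y i : E y -> 0 <= v y i <= (2 * L)%:R.
  move=> /Ex; rewrite /cball /= edistC => yx.
  have := le_trans (coord_le_enorm (y - x) i) yx.
  rewrite !mxE ler_norml /v natrM => /andP[h1 h2].
  by apply/andP; split; [apply: mulr_ge0|apply: ler_wpM2r]; rewrite ?ler0n //; lra.
pose cell (y : pt) : T := [ffun i => inord (Num.truncn (v y i))].
have cellP y z : E y -> E z -> cell y = cell z -> edist y z <= d%:R / L%:R.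
  move=> Ey Ez yz; apply: enorm_le_coord => i; rewrite !mxE.
  move/ffunP: yz => /(_ i); rewrite !ffunE => /(congr1 val) /=.
  have [/andP[y0 y1] /andP[z0 z1]] := (vP y i Ey, vP z i Ez).
  rewrite !inordK ?ltnS ?truncn_le_nat; first last.
  - by apply: le_lt_trans y1 _; rewrite ltr_nat.
  - by apply: le_lt_trans z1 _; rewrite ltr_nat.
  move=> /(truncn_eq_dist y0 z0).
  rewrite /v -mulrBl normrM (ger0_norm (ltW L0')) -ler_pdivlMr // div1r.
  by apply: le_trans; rewrite le_eqVlt; apply/orP; left; apply/eqP; congr (`| _ |); ring.
have /choice[c cP] (t : T) :
    exists c, E c /\ forall y, E y -> cell y = t -> edist c y <= d%:R / L%:R.
  have [[c Ec <-]|nc] := pselect (exists2 y, E y & cell y = t).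
    by exists c; split => // y Ey yc; exact: cellP.
  by exists e0; split => // y Ey yt; case: nc; exists y.
have cT : #|T| = ((2 * L).+1 ^ d)%N by rewrite card_ffun !card_ord.
exists (fun i => c (enum_val (cast_ord (esym cT) i))); split.
  by move=> i; case: (cP (enum_val (cast_ord (esym cT) i))).
move=> y Ey; exists (cast_ord cT (enum_rank (cell y))) => //.
rewrite /cball /= cast_ordK enum_rankK.
by case: (cP (cell y)) => _; exact.
Qed.

Lemma has_cover_le (E : set pt) (r s : R) n :
  r <= s -> has_cover E r n -> has_cover E s n.
Proof.
move=> rs [c [Ec cE]]; exists c; split => // y /cE[i _ ci].
by exists i => //; exact: le_trans ci rs.
Qed.

Lemma has_cover_gt0 (E : set pt) (r : R) n :
  E !=set0 -> has_cover E r n -> (0 < n)%N.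
Proof. by case: n => // -[e Ee] [c [_ /(_ _ Ee)[[]]]]. Qed.

(** An exponent [s > d] would force [C m^s <= M m^d] for all [m >= 1], by the grid cover of a ball
    of radius [1/2] at scale [1/(2m)]. *)
Lemma lowdim_set_ub (K : set pt) : K !=set0 -> ubound (lowdim_set K) d%:R.
Proof.
move=> [x Kx] s [s0 [C [C0 KC]]]; rewrite leNgt; apply/negP => ds.
(* For the [L] below, [2L + 1 = 4m(d + 1) + 1 <= (4d + 5) m], so the grid cover has at most [M m^d]
   balls. *)
pose M : R := (4 * d + 5)%:R ^+ d.
have key m : (0 < m)%N -> C * m%:R `^ (s - d%:R) <= M.
  move=> m0; have m0' : 0 < m%:R :> R by rewrite ltr0n.
  pose r : R := (2 * m%:R)^-1; pose L := (d.+1 * (2 * m))%N.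
  have L0 : (0 < L)%N by rewrite !muln_gt0 m0.
  have r0 : 0 < r by rewrite invr_gt0 mulr_gt0.
  have r1 : r <= 2^-1.
    by rewrite lef_pV2 ?posrE ?mulr_gt0 // ler_peMr // ler1n.
  have Ene : cball x 2^-1 `&` K !=set0.
    by exists x; split => //; rewrite /cball /= edistxx invr_ge0.
  have Esub : cball x 2^-1 `&` K `<=` cball x 1.
    by move=> y [yx _]; apply: le_trans yx _; lra.
  have Lr : d%:R / L%:R <= r.
    rewrite /L !natrM invfM mulrA ger_pMl // ler_pdivrMr // mul1r ler_nat.
    exact: leqnSn.
  have := KC r 2^-1 r0 r1 _ x Kx _ (has_cover_le Lr (grid_cover L0 Ene Esub)).
  rewrite invf_lt1 // ltr1n => /(_ isT).
  rewrite {1}/r invrK mulrA mulVf ?pnatr_eq0 // mul1r => h.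
  have {h} h : C * m%:R `^ s <= M * m%:R ^+ d.
    apply: le_trans h _; rewrite /M -exprMn natrX lerXn2r ?nnegrE //.
    by rewrite -natrM ler_nat /L; nia.
  rewrite powRB; last by rewrite (gt_eqF m0') implybT.
  by rewrite powR_mulrn ?(ltW m0') // mulrA ler_pdivrMr // exprn_gt0.
have sd : 0 < s - d%:R by rewrite subr_gt0.
pose B := M / C.
have B0 : 0 <= B by rewrite divr_ge0 ?exprn_ge0 // ltW.
(* This [m] exceeds [(M / C)^(1 / (s - d))], so [m^(s - d) > M / C]. *)
pose m := (Num.truncn (B `^ (s - d%:R)^-1)).+1.
have := key m isT; rewrite mulrC -ler_pdivlMr // leNgt => /negP; apply.
rewrite -[ltLHS]powRr1 // -{1}(mulVf (lt0r_neq0 sd)) powRrM gt0_ltr_powR //.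
- by rewrite nnegrE powR_ge0.
- by rewrite nnegrE.
- exact: truncnS_gt.
Qed.

End Covers.

(** * Iterated packings and lower bounds for covering numbers *)

Section BallFamilies.
Variables (R : realType) (d : nat).
Local Notation pt := 'rV[R]_d.
Implicit Types (p q : pt * R) (l : seq (pt * R)) (s : R).

(* A pair [p] stands for the closed ball of centre [p.1] and radius [p.2]. *)
Definition sep p q : bool := p.2 + q.2 < edist p.1 q.1.
Definition contained p q : bool := edist p.1 q.1 + p.2 <= q.2.
Definition mass s l : R := \sum_(p <- l) (2 * p.2) `^ s.

Lemma contained_trans p q p' : contained p q -> contained q p' -> contained p p'.
Proof. by rewrite /contained; have := edist_triangle q.1 p.1 p'.1; lra. Qed.

Lemma sep_contained p q p' q' :
  contained p p' -> contained q q' -> sep p' q' -> sep p q.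
Proof.
rewrite /contained /sep => pp qq; have := edist_triangle p.1 p'.1 q'.1.
have := edist_triangle q.1 p.1 q'.1; rewrite (edistC p'.1 p.1); lra.
Qed.

(** Families placed inside separated balls are separated from each other, so they can be
    concatenated and their masses add. *)
Lemma refine_families (P : pt * R -> Prop) s l : pairwise sep l ->
  (forall q, q \in l -> exists l', [/\ pairwise sep l',
     forall p, p \in l' -> P p /\ contained p q & (2 * q.2) `^ s <= mass s l']) ->
  exists l', [/\ pairwise sep l',
     forall p, p \in l' -> P p /\ exists2 q, q \in l & contained p q &
     mass s l <= mass s l'].
Proof.
elim: l => [|q l IHl]; first by exists [::].
rewrite pairwise_cons => /andP[/allP ql sl] H.
have [l2 [sep2 l2P mass2]] : exists l', [/\ pairwise sep l',
     forall p, p \in l' -> P p /\ exists2 q, q \in l & contained p q &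
     mass s l <= mass s l'].
  by apply: IHl sl _ => p pl; apply: H; rewrite inE pl orbT.
have [l1 [sep1 l1P mass1]] := H q (mem_head _ _).
exists (l1 ++ l2); split.
- rewrite pairwise_cat sep1 sep2 !andbT; apply/allrelP => p p' /l1P[_ pq] /l2P[_].
  by move=> [q' q'l p'q']; apply: sep_contained pq p'q' _; exact: ql.
- move=> p; rewrite mem_cat => /orP[/l1P|/l2P] [Pp].
    by move=> pq; split => //; exists q; rewrite ?mem_head.
  by move=> [q' q'l pq']; split => //; exists q'; rewrite // inE q'l orbT.
- by rewrite /mass big_cons big_cat /= lerD.
Qed.

(** Distinct centres are more than [2r] apart, so no covering ball of radius [r] contains two of
    them: sending a centre to a covering ball is injective. *)
Lemma separated_size_le (E : set pt) (r : R) n l : pairwise sep l ->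
  (forall p, p \in l -> E p.1 /\ r <= p.2) -> has_cover E r n -> (size l <= n)%N.
Proof.
move=> sl lE [c [_ Ec]].
have /choice[f fP] (p : pt * R) :
    exists i : option 'I_n, p \in l -> exists2 j, i = Some j & edist (c j) p.1 <= r.
  have [pl|_] := boolP (p \in l); last by exists None.
  have [/Ec[i _ ci] _] := lE _ pl.
  by exists (Some i) => _; exists i.
have lf : {subset map f l <= map Some (enum 'I_n)}.
  move=> _ /mapP[p /fP[j -> _] ->]; apply: map_f; exact: mem_enum.
have := uniq_leq_size _ lf; rewrite (size_map f) (size_map Some) size_enum_ord; apply.
rewrite uniq_pairwise pairwise_map; apply: (sub_in_pairwise _ (allss l)) sl.
move=> p q pl ql; rewrite /sep /= => pq; apply/eqP => fpq.
have [j fp cp] := fP _ pl; have [k fq cq] := fP _ ql.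
move: fpq cq; rewrite fp fq => -[<-] cq.
have [_ rp] := lE _ pl; have [_ rq] := lE _ ql.
have := edist_triangle (c j) p.1 q.1; rewrite (edistC p.1 (c j)); lra.
Qed.

Section Iteration.
Variables (K : set pt) (s eps R0 : R).
Hypotheses (s0 : 0 < s) (eps0 : 0 < eps) (eps1 : eps <= 1) (R00 : 0 < R0) (R01 : R0 <= 1).
Hypothesis rich : forall x rho, K x -> 0 < rho -> rho <= R0 ->
  exists l, [/\ pairwise sep l,
    forall p, p \in l ->
      [/\ K p.1, edist p.1 x <= rho, eps * rho <= p.2 & p.2 <= rho] &
    (4 * rho) `^ s <= mass s l].

(** A ball of radius at most [r] is kept; a larger one is refined by [rich]. Each refinement at
    least halves the radius, so [n] rounds suffice, and it starts from a radius above [r], so no new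
    radius falls below [eps / 2 * r]. *)
Lemma iterate_families n q r : K q.1 -> 0 < r -> eps / 2 * r <= q.2 ->
  q.2 <= 2 ^+ n * r -> q.2 <= R0 ->
  exists l, [/\ pairwise sep l,
    forall p, p \in l -> [/\ K p.1, eps / 2 * r <= p.2 & p.2 <= r] /\ contained p q &
    (2 * q.2) `^ s <= mass s l].
Proof.
elim: n q => [|n IHn] q Kq r0 rq qr qR.
  rewrite expr0 mul1r in qr; exists [:: q]; split => //.
    move=> p; rewrite inE => /eqP ->; split => //.
    by rewrite /contained edistxx add0r.
  by rewrite /mass big_seq1.
have [qr'|rq'] := leP q.2 r.
  exists [:: q]; split => //.
    move=> p; rewrite inE => /eqP ->; split => //.
    by rewrite /contained edistxx add0r.
  by rewrite /mass big_seq1.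
have q0 : 0 < q.2 by lra.
(* Half the radius is used so that balls centred within [q.2 / 2], of radius at most [q.2 / 2], stay
   inside [q]; then [4 rho = 2 q.2] matches the mass of [q]. *)
have [|||l [sl lP lm]] := @rich q.1 (q.2 / 2); [by []|lra|lra|].
have [|l' [sl' l'P l'm]] := @refine_families
    (fun p => [/\ K p.1, eps / 2 * r <= p.2 & p.2 <= r]) s l sl.
  move=> p /lP[Kp pq ep pe]; apply: IHn => //.
  - apply: le_trans ep; rewrite -mulrA ler_wpM2l ?(ltW eps0) //; lra.
  - by rewrite exprS in qr; lra.
  - lra.
exists l'; split => //.
  move=> p /l'P[Pp [p' /lP[_ p'q _ p'2] pp']]; split => //.
  by apply: contained_trans pp' _; rewrite /contained; lra.
by apply: le_trans l'm; apply: le_trans lm; rewrite (_ : 2 * q.2 = 4 * (q.2 / 2)) //; lra.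
Qed.

(** A family with radii in [[r, t]] and mass at least [(2 rho)^s] has at least [(rho / t)^s]
    members, and separation bounds this number by that of any [r]-cover. *)
Lemma lowdim_set_of_families : lowdim_set K s.
Proof.
split => //; exists ((eps / 2 * R0) `^ s).
have c0 : 0 < eps / 2 * R0 by rewrite mulr_gt0 // divr_gt0.
split; first exact: powR_gt0.
move=> r Rr r0 rR R1 x Kx n cov.
have Rr0 : 0 < Rr by lra.
rewrite -powRM ?divr_ge0 ?(ltW c0) ?(ltW Rr0) ?(ltW r0) //.
(* At most [R0], so that [rich] applies, and at most [Rr], so that the family stays in the given
   ball; being proportional to [Rr], it only costs a constant. *)
pose rho := Rr * R0.
have rho0 : 0 < rho by rewrite mulr_gt0.
have rhoR0 : rho <= R0 by rewrite ger_pMl // ltW.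
have rhoR : rho <= Rr by rewrite ger_pMr.
rewrite (_ : eps / 2 * R0 * (Rr / r) = eps / 2 * rho / r); last first.
  by rewrite /rho; field; exact: lt0r_neq0.
(* If the base is at most 1, the bound is at most 1, and any cover of a non-empty set has a
   member. *)
have [small|big] := leP (eps / 2 * rho / r) 1.
  have n0 : (0 < n)%N.
    apply: has_cover_gt0 cov; exists x; split => //.
    by rewrite /cball /= edistxx ltW.
  apply: (@le_trans _ _ 1); last by rewrite ler1n.
  have E1 : 1 = 1 `^ s :> R by rewrite powR1.
  rewrite [leRHS]E1 ge0_ler_powR ?(ltW s0) ?nnegrE //.
  by rewrite divr_ge0 ?(ltW r0) // mulr_ge0 ?(ltW rho0) // divr_ge0 ?(ltW eps0).
(* Stopping at scale [2 r / eps] keeps every radius of the family above [r]. *)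
pose t := 2 * r / eps.
have t0 : 0 < t by rewrite divr_gt0 // mulr_gt0.
have et : eps / 2 * t = r by rewrite /t; field; exact: lt0r_neq0.
have trho : t <= rho.
  have : 1 * r < eps / 2 * rho by rewrite -ltr_pdivlMr.
  rewrite mul1r -et ltr_pM2l ?divr_gt0 //; exact: ltW.
have [N NP] : exists N, rho <= 2 ^+ N * t.
  exists (Num.truncn (rho / t)).+1; rewrite -ler_pdivrMr //.
  apply: le_trans (ltW (truncnS_gt _)) _.
  by rewrite -natrX ler_nat ltnW // ltn_expl.
have er : eps * rho <= rho by rewrite ger_pMl.
have rrho : r < eps / 2 * rho by move: big; rewrite ltr_pdivlMr // mul1r.
have [|l [sl lP lm]] := @iterate_families N (x, rho) t Kx t0 _ NP rhoR0.
  by rewrite et /=; lra.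
rewrite et in lP.
have ln : (size l <= n)%N.
  apply: (separated_size_le sl _ cov) => p /lP[[Kp rp _] pq]; split => //.
  split => //; rewrite /cball /=; move: pq; rewrite /contained /= edistC; lra.
have {}lm : (2 * rho) `^ s <= n%:R * (2 * t) `^ s.
  apply: le_trans lm _; rewrite /mass big_seq.
  apply: (@le_trans _ _ (\sum_(p <- l) (2 * t) `^ s)).
    rewrite [leRHS]big_seq; apply: ler_sum => p /lP[[_ rp pt] _].
    by rewrite ge0_ler_powR ?(ltW s0) ?nnegrE //; lra.
  rewrite big_const_seq count_predT iter_addr_0 -[leLHS]mulr_natl.
  by rewrite ler_wpM2r ?powR_ge0 // ler_nat.
have rhor : 0 <= eps / 2 * rho / r by exact/ltW/lt_trans/big.
have tt : 0 < 2 * t by rewrite mulr_gt0.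
rewrite -(ler_pM2r (powR_gt0 s tt)) -powRM //; last exact: ltW.
rewrite (_ : eps / 2 * rho / r * (2 * t) = 2 * rho) // -et; field.
by rewrite !lt0r_neq0.
Qed.

End Iteration.
End BallFamilies.

(** * Compactness for the Hausdorff distance *)

Section HausdorffLimits.
Variables (R : realType) (d : nat).
Local Notation pt := 'rV[R]_d.

Lemma cball_cover (x : pt) (r : R) : 0 < r -> exists n, has_cover (cball x 1) r n.
Proof.
move=> r0; pose L := (Num.truncn (d%:R / r)).+1.
exists ((2 * L).+1 ^ d)%N; apply: has_cover_le (@grid_cover _ _ x _ L isT _ _) => //.
- rewrite ler_pdivrMr // mulrC -ler_pdivrMr //; exact/ltW/truncnS_gt.
- by exists x; rewrite /cball /= edistxx.
Qed.

(** [F] consists of the points all of whose balls meet [A n] for [U]-almost all [n]. A finite cover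
    of the unit ball by balls of radius [e / 3] makes the approximation uniform. *)
Lemma hausdorff_cluster (A : nat -> set pt) :
  (forall n, A n !=set0) -> (forall n, A n `<=` cball 0 1) ->
  exists F, [/\ F !=set0, compact F & forall e N, 0 < e ->
    exists n, [/\ (N <= n)%N, A n `<=` enbhd F e & F `<=` enbhd (A n) e]].
Proof.
move=> A0 A1.
have [U [UU Uoo]] := ultraFilterLemma (F := \oo) _.
pose F : set pt := [set y | forall e, 0 < e -> U [set n | A n `&` cball y e !=set0]].
(* Points chosen in the [A n] within the compact ball cluster along [U]; for an ultrafilter a
   cluster point is a limit, hence lies in [F]. *)
have limF c r : U [set n | A n `&` cball c r !=set0] -> F `&` cball c r !=set0.
  move=> Uc.
  have /choice[a aP] n : exists x, (A n `&` cball c r !=set0) -> A n x /\ cball c r x.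
    have [[x [Ax cx]]|no] := pselect (A n `&` cball c r !=set0); first by exists x.
    by exists c => /no.
  have [|p [cp pa]] := @compact_cball _ _ c r (a @ U) _.
    suff : U (a @^-1` cball c r) by [].
    by apply: filterS Uc => n /aP[].
  exists p; split => // e e0.
  have [|nU] := in_ultra_setVsetC (a @^-1` cball p e) UU.
    by move=> Ua; apply: filterS2 Uc Ua => n /aP[An _] pn; exists (a n).
  have aU : (a @ U) (~` cball p e) by exact: nU.
  by have [y []] := pa _ _ aU (cball_nbhs p e0).
have F1 : F `<=` cball 0 1.
  move=> y Fy; rewrite /cball /=; apply/ler_addgt0Pr => e e0.
  have [n [a [/A1 a1 ya]]] := filter_ex (Fy e e0).
  by apply: le_trans (edist_triangle a _ _) _; rewrite lerD // edistC.
have Fcl : closed F.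
  move=> y yF e e0; have e20 : 0 < e / 2 by rewrite divr_gt0.
  have [z Fz yz] := closure_cball yF e20.
  apply: filterS (Fz _ e20) => n [a [An za]]; exists a; split => //.
  apply: le_trans (edist_triangle z _ _) _; move: za; rewrite /cball /=; lra.
exists F; split.
- have [|p [Fp _]] := limF 0 1; last by exists p.
  apply: filterE => n; have [a An] := A0 n.
  by exists a; split => //; exact: A1 An.
- exact: compact_sub_cball F1.
move=> e N e0; have e30 : 0 < e / 3 by rewrite divr_gt0.
have [m [c [_ cov]]] := cball_cover 0 e30.
(* The first clause puts [A n] within [2e / 3] of [F], the second puts [F] within [e] of [A n]. *)
pose P i n := (A n `&` cball (c i) (e / 3) !=set0 -> F `&` cball (c i) (e / 3) !=set0)
  /\ (F `&` cball (c i) (e / 3) !=set0 -> A n `&` cball (c i) (2 * (e / 3)) !=set0).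
have : U [set n | (N <= n)%N /\ forall i, P i n].
  apply: filterI; first by apply: Uoo; exact: nbhs_infty_ge.
  apply: filter_forall => i; apply: filterI.
    (* Either [U]-almost all [A n] meet the ball, and then so does [F], or [U]-almost all miss it
       and the clause is vacuous. *)
    have [/limF Fi|nUi] := in_ultra_setVsetC [set n | A n `&` cball (c i) (e / 3) !=set0] UU.
      by apply: filterE.
    by apply: filterS nUi => n.
  have [[f [Ff cf]]|no] := pselect (F `&` cball (c i) (e / 3) !=set0).
    apply: filterS (Ff _ e30) => n [a [An fa]] _; exists a; split => //.
    apply: le_trans (edist_triangle f _ _) _.
    by move: cf fa; rewrite /cball /=; lra.
  by apply: filterE.
move=> /filter_ex[n [Nn nP]]; exists n; split => //.
- move=> a Aa; have [i _ ca] := cov a (A1 _ _ Aa).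
  have [|f [Ff cf]] := (nP i).1; first by exists a.
  exists f => //; apply: le_trans (edist_triangle (c i) _ _) _.
  by move: ca cf; rewrite /cball /= (edistC f); lra.
- move=> f Ff; have [i _ cf] := cov f (F1 _ Ff).
  have [|a [Aa ca]] := (nP i).2; first by exists f.
  exists a => //; apply: le_trans (edist_triangle (c i) _ _) _.
  by move: ca cf; rewrite /cball /= (edistC a); lra.
Qed.

Lemma hdist_le (A B : set pt) (e : R) : 0 <= e ->
  A `<=` enbhd B e -> B `<=` enbhd A e -> (hdist A B <= e%:E)%E.
Proof. by move=> e0 AB BA; apply: ereal_inf_lbound; exists e. Qed.

Lemma hdist_ge0 (A B : set pt) : (0 <= hdist A B)%E.
Proof. by apply: le_ereal_inf_tmp => _ [e [e0 _] <-]; rewrite lee_fin. Qed.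

End HausdorffLimits.

(** * Finitely many eventual conditions *)

Lemma near_all (T : eqType) (I : Type) (U : set_system I) (FU : Filter U)
    (P : I -> pred T) (l : seq T) :
  (forall x, x \in l -> \forall n \near U, P n x) -> \forall n \near U, all (P n) l.
Proof.
elim: l => [|x l IHl] H /=; first exact: filterE.
apply: filterS2 (H x (mem_head _ _)) (IHl _) => [n -> ->//|y yl].
by apply: H; rewrite inE yl orbT.
Qed.

Lemma near_pairwise (T : eqType) (I : Type) (U : set_system I) (FU : Filter U)
    (r0 : rel T) (r : I -> rel T) (l : seq T) :
  (forall x y, x \in l -> y \in l -> r0 x y -> \forall n \near U, r n x y) ->
  pairwise r0 l -> \forall n \near U, pairwise (r n) l.
Proof.
elim: l => [|x l IHl] H /=; first by move=> _; exact: filterE.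
move=> /andP[/allP xl l0].
have lH : \forall n \near U, pairwise (r n) l.
  by apply: IHl l0 => y z yl zl; apply: H; rewrite inE ?yl ?zl orbT.
have xH : \forall n \near U, all (r n x) l.
  apply: near_all => y yl; apply: H (xl _ yl); first exact: mem_head.
  by rewrite inE yl orbT.
by apply: filterS2 xH lH => n -> ->.
Qed.

(** * Packing sums under Hausdorff limits, and packing measures *)

Section PackingLimit.
Variables (R : realType) (d : nat).
Local Notation pt := 'rV[R]_d.
Implicit Types (l : seq (pt * R)) (s : R).

Lemma powR_cvg (a s : R) (u : nat -> R) :
  0 < a -> u n @[n --> \oo] --> s -> a `^ u n @[n --> \oo] --> a `^ s.
Proof.
move=> a0 us; rewrite /powR gt_eqF //.
have ul : u n * ln a @[n --> \oo] --> s * ln a by exact: cvgM us (cvg_cst _).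
exact: continuous_cvg (@continuous_expR R _) ul.
Qed.

Lemma mass_cvg s (u : nat -> R) l : (forall p, p \in l -> 0 < p.2) ->
  u n @[n --> \oo] --> s -> mass (u n) l @[n --> \oo] --> mass s l.
Proof.
move=> + us; elim: l => [|p l IHl] l0.
  rewrite /mass big_nil (_ : (fun n => _) = fun=> 0); first exact: cvg_cst.
  by apply/funext => n; rewrite big_nil.
rewrite /mass big_cons.
rewrite (_ : (fun n => _) = fun n => (2 * p.2) `^ u n + mass (u n) l); last first.
  by apply/funext => n; rewrite big_cons.
apply: cvgD; first by apply: powR_cvg us; rewrite mulr_gt0 // l0 ?mem_head.
by apply: IHl => q ql; apply: l0; rewrite inE ql orbT.
Qed.

(** The centres of a finite family in [F] are moved to nearby points of [A n], radii unchanged. For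
    large [n] separation persists and all radii exceed [1 / (n + 1)], so the bound for [A n]
    applies; then the exponents converge. *)
Lemma mass_limit_le (A : nat -> set pt) (F : set pt) s (u : nat -> R) :
  u n @[n --> \oo] --> s ->
  (forall n, F `<=` enbhd (A n) n.+1%:R^-1) ->
  (forall n l, pairwise (@sep R d) l ->
    (forall p, p \in l -> [/\ A n p.1, n.+1%:R^-1 <= p.2 & p.2 <= 1]) ->
    mass (u n) l <= 4 `^ u n) ->
  forall l, pairwise (@sep R d) l ->
    (forall p, p \in l -> [/\ F p.1, 0 < p.2 & p.2 <= 1]) -> mass s l <= 4 `^ s.
Proof.
move=> us FA Abd l sl lF.
have /choice[a aP] n : exists f : pt -> pt, forall y, F y ->
    A n (f y) /\ edist (f y) y <= n.+1%:R^-1.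
  have /choice[f fP] y : exists z, F y -> A n z /\ edist z y <= n.+1%:R^-1.
    have [/FA - /(_ n)[z Az zy]|nF] := pselect (F y); first by exists z.
    by exists y => /nF.
  by exists f.
pose move_centre n (p : pt * R) := (a n p.1, p.2).
have near_inv (e : R) : 0 < e -> \forall n \near \oo, n.+1%:R^-1 < e.
  by move=> e0; have := near_infty_natSinv_lt (PosNum e0).
apply: (ler_cvg_to (mass_cvg (l := l) _ us) (powR_cvg _ us)) => //.
  by move=> p /lF[].
have small : \forall n \near \oo, all (fun p => n.+1%:R^-1 <= p.2) l.
  by apply: near_all => p /lF[_ /near_inv p0 _]; apply: filterS p0 => n /ltW.
have nsep : \forall n \near \oo, pairwise (relpre (move_centre n) (@sep R d)) l.
  apply: near_pairwise sl => p q /lF[Fp _ _] /lF[Fq _ _].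
  rewrite /sep -subr_gt0 => pq.
  (* Each of the two centres moves by less than half the gap. *)
  have pq2 : 0 < (edist p.1 q.1 - (p.2 + q.2)) / 2 by rewrite divr_gt0.
  apply: filterS (near_inv _ pq2) => n /= nlt.
  have [_ ap] := aP n _ Fp; have [_ aq] := aP n _ Fq.
  move: nlt ap aq; move: (n.+1%:R^-1) => e nlt ap aq.
  have := edist_triangle (a n p.1) p.1 q.1; rewrite (edistC p.1 (a n p.1)) /=.
  have := edist_triangle (a n q.1) (a n p.1) q.1; lra.
apply: filterS2 small nsep => n /allP sm ns.
have -> : mass (u n) l = mass (u n) (map (move_centre n) l) by rewrite /mass big_map.
apply: Abd; first by rewrite pairwise_map.
move=> _ /mapP[p pl ->] /=; have [Fp _ p1] := lF _ pl.
by split => //; [case: (aP n _ Fp)|exact: sm].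
Qed.

(** The infimum over [delta] is bounded by its value at [delta = 1], and a sum over a countable
    family is the supremum of its finite subsums. *)
Lemma packing_pre_le (F : set pt) s M :
  (forall l, pairwise (@sep R d) l ->
    (forall p, p \in l -> [/\ F p.1, 0 < p.2 & p.2 <= 1]) -> mass s l <= M) ->
  (packing_pre s F <= M%:E)%E.
Proof.
move=> FM; apply: ge_ereal_inf; exists (ereal_sup (pack_sum s F 1)).
  by exists 1 => //=.
apply: ge_ereal_sup => _ [I [x [r [IF [Id ->]]]]].
apply: ge_ereal_sup => _ [J [Jfin JI] <-].
rewrite fsbig_finite // sumEFin lee_fin.
have JP i : i \in finmap.enum_fset (fset_set J) -> I i.
  by move=> iJ; apply: JI; rewrite -in_setE -(in_fset_set Jfin).
set t := finmap.enum_fset _ in JP *.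
have -> : \sum_(i <- t) (2 * r i) `^ s = mass s [seq (x i, r i) | i <- t].
  by rewrite /mass big_map.
apply: FM; last by move=> _ /mapP[i /JP/IF[? [? ?]] ->].
rewrite pairwise_map; have : uniq t by exact: finmap.fset_uniq.
rewrite uniq_pairwise; apply: (sub_in_pairwise _ (allss t)).
move=> i j /JP Ii /JP Ij /= /eqP ij; rewrite /sep /=.
have [[ri _] [rj _]] := (IF _ Ii, IF _ Ij).
by apply: cball_disjoint_lt => //; exact: Id.
Qed.

Lemma packing_pre_set0 s : packing_pre s (set0 : set pt) = 0%E.
Proof.
rewrite /packing_pre (_ : [set _ | _ in _] = [set 0%E]) ?ereal_inf1 //.
have E e : pack_sum s (set0 : set pt) e = [set 0%E].
  apply/seteqP; split => v /=.
    move=> [I [x [r [IF [_ ->]]]]]; apply: esum1 => i /IF[_ [_ []]].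
  move=> ->; exists set0, (fun=> 0), (fun=> 0); split => //; split => //.
  by rewrite esum_set0.
apply/seteqP; split => v /=.
  by move=> [e _ <-]; rewrite E ereal_sup1.
by move=> ->; exists 1 => //; rewrite E ereal_sup1.
Qed.

Lemma packing_pre_ge0 (F : set pt) s : (0 <= packing_pre s F)%E.
Proof.
apply: le_ereal_inf_tmp => _ [e e0 <-]; apply: ereal_sup_ubound.
exists set0, (fun=> 0), (fun=> 0); split => //; split => //.
by rewrite esum_set0.
Qed.

Lemma packing_measure_le_pre (F : set pt) s :
  (packing_measure s F <= packing_pre s F)%E.
Proof.
apply: ge_ereal_inf.
(* The trivial cover of [F]: the set itself, then empty sets. *)
pose Ei (i : nat) : set pt := if i == 0%N then F else set0.
exists (\esum_(i in [set: nat]) packing_pre s (Ei i))%E.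
  by exists Ei => //= y Fy; exists 0%N.
rewrite (eq_esum (b := fun i => if i \in [set 0%N] then packing_pre s F else 0%E)).
  by rewrite -esum_mkcond esum_set1 ?packing_pre_ge0.
move=> i _; rewrite /Ei; have [->|i0] := eqVneq i 0%N; first by rewrite mem_set.
by rewrite memNset ?packing_pre_set0 //; apply/eqP.
Qed.

End PackingLimit.

(** * Balls with small packing sums, and their rescalings *)

Section SparseScales.
Variables (R : realType) (d : nat) (K : set 'rV[R]_d).
Local Notation pt := 'rV[R]_d.

(** Contrapositive of [lowdim_set_of_families]: some ball of radius at most [R0] violates [rich]. *)
Lemma exists_sparse_ball (s eps R0 : R) :
  0 < s -> 0 < eps -> eps <= 1 -> 0 < R0 -> R0 <= 1 -> ~ lowdim_set K s ->
  exists q : pt * R, [/\ K q.1, 0 < q.2, q.2 <= R0 &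
    forall l, pairwise (@sep R d) l ->
      (forall p, p \in l ->
        [/\ K p.1, edist p.1 q.1 <= q.2, eps * q.2 <= p.2 & p.2 <= q.2]) ->
      mass s l < (4 * q.2) `^ s].
Proof.
move=> s0 eps0 eps1 R00 R01 nK; apply: contrapT => nq; apply: nK.
apply: (lowdim_set_of_families s0 eps0 eps1 R00 R01) => x rho Kx rho0 rhoR.
apply: contrapT => nl; apply: nq; exists (x, rho); split => //= l sl lP.
by rewrite ltNge; apply/negP => lm; apply: nl; exists l.
Qed.

Definition zoom (q : pt * R) : set pt :=
  [set q.2^-1 *: (y - q.1) | y in K] `&` cball 0 1.

(** The similarity [y -> q.1 + q.2 y] multiplies masses by [q.2^s] and preserves separation, so the
    bound [(4 q.2)^s] becomes [4^s]. *)
Lemma zoom_mass_le (s eps : R) (q : pt * R) : 0 < eps -> 0 < q.2 ->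
  (forall l, pairwise (@sep R d) l ->
    (forall p, p \in l ->
      [/\ K p.1, edist p.1 q.1 <= q.2, eps * q.2 <= p.2 & p.2 <= q.2]) ->
    mass s l < (4 * q.2) `^ s) ->
  forall l, pairwise (@sep R d) l ->
    (forall p, p \in l -> [/\ zoom q p.1, eps <= p.2 & p.2 <= 1]) -> mass s l <= 4 `^ s.
Proof.
move=> eps0 q0 sparse l sl lP.
pose f (p : pt * R) : pt * R := (q.1 + q.2 *: p.1, q.2 * p.2).
have fm : mass s (map f l) = q.2 `^ s * mass s l.
  rewrite /mass big_map mulr_sumr !big_seq; apply: eq_bigr => p /lP[_ ep p1] /=.
  rewrite -powRM ?(ltW q0) //; first by congr (_ `^ _); ring.
  by rewrite mulr_ge0 // (le_trans (ltW eps0)).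
rewrite -(ler_pM2l (powR_gt0 s q0)) -powRM ?(ltW q0) // -fm (mulrC q.2).
have fd (y z : pt) : edist (q.1 + q.2 *: y) (q.1 + q.2 *: z) = q.2 * edist y z.
  by rewrite /edist opprD addrACA subrr add0r -scalerBr enormZ gtr0_norm.
apply/ltW/sparse.
  rewrite pairwise_map; apply: sub_pairwise sl => p p'.
  by rewrite /sep /= fd -mulrDr ltr_pM2l.
move=> _ /mapP[p /lP[[[y Ky yp] p1] ep pe] ->] /=; split.
- by rewrite -yp scalerA divff ?lt0r_neq0 // scale1r addrC subrK.
- rewrite /edist addrC addKr enormZ gtr0_norm // ger_pMr //.
  by move: p1; rewrite /cball /= /edist sub0r enormN.
- by rewrite mulrC ler_wpM2l // ltW.
- by rewrite ger_pMr.
Qed.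

End SparseScales.

(** * Construction of the weak tangent *)

Unset Implicit Arguments.

Theorem theorem3p8 (R : realType) (d : nat) (K : set 'rV[R]_d) :
  K !=set0 -> compact K ->
  exists F : set 'rV[R]_d, weak_tangent K F /\
    (packing_pre (dimL K) F <= (powR 257 (dimL K))%:E)%E /\
    ((powR 257 (dimL K))%:E < +oo)%E /\
    (packing_measure (dimL K) F < +oo)%E.
Proof.
move=> K0 _; set beta := dimL K.
(* Boundedness makes [dimL K] a true upper bound, not the default value of [sup]. *)
have Kub : has_ubound (lowdim_set K) by exists d%:R; exact: lowdim_set_ub.
have beta0 : 0 <= beta.
  have [[s Ks]|no] := pselect (lowdim_set K !=set0).
    by apply: le_trans (ub_le_sup Kub Ks); case: Ks => /ltW.
  rewrite /beta /dimL (_ : lowdim_set K = set0) ?sup0 //.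
  by apply/seteqP; split => // s Ks; case: no; exists s.
(* One sequence serves as excess of the exponent over [beta], least relative radius, bound on the
   radius of the [n]-th ball, and Hausdorff error. *)
pose eps n : R := n.+1%:R^-1.
have eps0 n : 0 < eps n by rewrite invr_gt0.
have eps1 n : eps n <= 1 by rewrite invf_le1 // ler1n.
have nK n : ~ lowdim_set K (beta + eps n).
  by move=> /(ub_le_sup Kub); rewrite leNgt ltrDl eps0.
have /choice[q qP] n := exists_sparse_ball
  (ltr_wpDl beta0 (eps0 n)) (eps0 n) (eps1 n) (eps0 n) (eps1 n) (@nK n).
have zoom0 n : zoom K (q n) !=set0.
  exists 0; split; last by rewrite /cball /= edistxx.
  by exists (q n).1; [case: (qP n)|rewrite subrr scaler0].
have zoom1 n : zoom K (q n) `<=` cball 0 1 by move=> y [].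
have [F [F0 Fco Fzoom]] := hausdorff_cluster zoom0 zoom1.
(* Only [phi k >= k] is required of the subsequence, not monotonicity. *)
have /choice[phi phiP] k := Fzoom (eps k) k (eps0 k).
have eps_phi k : eps (phi k) <= eps k.
  by have [kp _ _] := phiP k; rewrite lef_pV2 ?posrE // ler_nat.
have eps_cvg : eps n @[n --> \oo] --> (0 : R) by exact: cvg_harmonic.
have epsphi_cvg : eps (phi n) @[n --> \oo] --> (0 : R).
  apply: squeeze_cvgr (cvg_cst _) eps_cvg.
  by apply: filterE => n; rewrite eps_phi ltW.
have pre_le : (packing_pre beta F <= (4 `^ beta)%:E)%E.
  apply: packing_pre_le.
  apply: (@mass_limit_le _ _ (fun n => zoom K (q (phi n))) F beta
    (fun n => beta + eps (phi n))).
  - by rewrite -[X in _ --> X]addr0; apply: cvgD epsphi_cvg; exact: cvg_cst.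
  - by move=> n; have [_ _] := phiP n.
  - move=> n l sl lP; have [_ q0 _ sparse] := qP (phi n).
    apply: (zoom_mass_le (eps0 (phi n)) q0 sparse sl) => p /lP[zp ep pe].
    by split => //; apply: le_trans ep; exact: eps_phi.
exists F; split; last first.
  split; last split; last first.
  - exact: le_lt_trans (packing_measure_le_pre _ _) (le_lt_trans pre_le (ltry _)).
  - exact: ltry.
  (* Here [4 <= 257] and [beta >= 0]. *)
  - apply: le_trans pre_le _.
    by rewrite lee_fin ge0_ler_powR ?nnegrE // ler_nat.
split => //; split => //.
exists (fun n => (q (phi n)).1), (fun n => (q (phi n)).2^-1); split; last split; last split.
- by move=> n; have [] := qP (phi n).
- by move=> n; have [_ q0 qe _] := qP (phi n); rewrite invf_ge1 // (le_trans qe).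
- apply/cvgryPge => B; apply: filterS (nbhs_infty_ger B) => n Bn.
  have [_ q0 qe _] := qP (phi n).
  (* Since the radius is at most [eps (phi n) <= eps n], the zoom factor is at least [n + 1]. *)
  apply: le_trans Bn _; apply: (@le_trans _ _ n.+1%:R); first by rewrite ler_nat.
  rewrite -[leLHS]invrK lef_pV2 ?posrE ?eps0 //.
  exact: le_trans qe (eps_phi n).
- split; first by move=> n; exact: zoom0.
  have epsE : (eps n)%:E @[n --> \oo] --> (0 : R)%:E
    by apply: cvg_EFin eps_cvg; exact: filterE.
  apply: squeeze_cvge (cvg_cst _) epsE; apply: filterE => n.
  rewrite hdist_ge0 /=; have [_ zF Fz] := phiP n.
  exact: hdist_le (ltW (eps0 n)) zF Fz.
Qed.
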